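(* Let $(k_n)_{n\ge1}$ be a sequence of positive integers with $k_n\le n$ and $$\limsup_{n\to\infty}\frac{k_n}{n^{4/9}}=\infty .$$ Then the weak law of large numbers fails for $Z_{n,k_n}$; that is, it is not true that $\dfrac{Z_{n,k_n}}{E Z_{n,k_n}}\to 1$ in probability as $n\to\infty$.
   Context: $S_n$ denotes the symmetric group of permutations of $\{1,\dots,n\}$, equipped with the uniform probability measure $U_n$; $P$ and $E$ denote probability and expectation under $U_n$. For $\sigma\in S_n$, an increasing subsequence of length $k$ is a set $\{x_1<\dots<x_k\}\subset\{1,\dots,n\}$ of values that appear in $\sigma$ (in one-line notation $\sigma(1)\sigma(2)\cdots\sigma(n)$) in increasing order from left to right, i.e. $\sigma^{-1}(x_1)<\dots<\sigma^{-1}(x_k)$. $Z_{n,k}(\sigma)$ is the number of increasing subsequences of length $k$ in $\sigma$. One has $EZ_{n,k}=\binom{n}{k}/k!$. *)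

(* Defs.v *)
From HB Require Import structures.
From mathcomp Require Import all_boot all_order all_algebra all_fingroup.
From mathcomp Require Import all_classical all_reals all_analysis.
Set Implicit Arguments. Unset Strict Implicit. Unset Printing Implicit Defensive.
Import Order.TTheory GRing.Theory Num.Theory.

(* Permutations of {1..n} are modelled as 'S_n = {perm 'I_n} (values 0..n-1).
   An increasing subsequence of length k of s is a k-subset A of values such that
   x < y in A implies s^-1 x < s^-1 y. *)
Definition incr_set (n : nat) (s : 'S_n) (A : {set 'I_n}) : bool :=
  [forall x in A, forall y in A, (x < y)%N ==> ((s^-1)%g x < (s^-1)%g y)%N].

Definition Z (n k : nat) (s : 'S_n) : nat :=
  #|[set A : {set 'I_n} | (#|A| == k) && incr_set s A]|.

Local Open Scope ring_scope.

Definition Pn (R : realType) (n : nat) (E : pred 'S_n) : R :=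
  #|[set s : 'S_n | E s]|%:R / #|{perm 'I_n}|%:R.

Definition EZ (R : realType) (n k : nat) : R :=
  (\sum_(s : 'S_n) (Z k s)%:R) / #|{perm 'I_n}|%:R.

(* Main.v *)
Require Import Defs.
From HB Require Import structures.
From mathcomp Require Import all_boot all_order all_algebra all_fingroup.
From mathcomp Require Import all_classical all_reals all_analysis.
From mathcomp Require Import ring lra zify.
Set Implicit Arguments. Unset Strict Implicit. Unset Printing Implicit Defensive.
Import Order.TTheory GRing.Theory Num.Theory numFieldNormedType.Exports.
Local Open Scope ring_scope.

(** If Z/EZ were close to 1 in probability, reweighting the uniform law by Z/EZ
    would hardly change it.  The reweighted law is a planted one: choose a uniform
    permutation and a uniform k-subset A of the values, and rearrange the values
    of A in increasing order over the positions they occupy.  With a grid of step h,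
    Chebyshev's inequality shows that A and its set of positions both have about
    k*j*h/n elements below each grid point j*h; comparing ranks, the sorted part then
    lies within 3h of the diagonal.  So planting adds nearly k points to this strip,
    whereas under the uniform law the strip has at most 6h points on average with
    variance O(h).  The two laws are separated as soon as k^2 >> h, while the grid
    argument needs k*h^3 >> n^3; both can be met when k^7 >> n^3, which is weaker
    than k >> n^(4/9). *)

(** * Averages over a finite type, Markov and Chebyshev *)

Section Average.
Variable R : realFieldType.
Implicit Types T : finType.

Definition avg T (f : T -> R) : R := (\sum_x f x) / #|T|%:R.

Lemma avgD T (f g : T -> R) : avg (fun x => f x + g x) = avg f + avg g.
Proof. by rewrite /avg big_split mulrDl. Qed.

Lemma avgZ T (c : R) (f : T -> R) : avg (fun x => c * f x) = c * avg f.
Proof. by rewrite /avg -mulr_sumr mulrA. Qed.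

Lemma eq_avg T (f g : T -> R) : f =1 g -> avg f = avg g.
Proof. by move=> fg; rewrite /avg (eq_bigr _ (fun x _ => fg x)). Qed.

Lemma avg_sum T (I : Type) (r : seq I) (P : pred I) (f : I -> T -> R) :
  avg (fun x => \sum_(i <- r | P i) f i x) = \sum_(i <- r | P i) avg (f i).
Proof. by rewrite /avg exchange_big mulr_suml. Qed.

Lemma le_avg T (f g : T -> R) : (forall x, f x <= g x) -> avg f <= avg g.
Proof. by move=> fg; rewrite ler_wpM2r ?invr_ge0 // ler_sum. Qed.

Lemma avg_cst T (c : R) : (0 < #|T|)%N -> avg (fun _ : T => c) = c.
Proof.
move=> T0; rewrite /avg sumr_const -(mulr_natr c) mulfK //.
by rewrite pnatr_eq0 -lt0n.
Qed.

Lemma avg_bij T (h : T -> T) (f : T -> R) : injective h ->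
  avg (fun x => f (h x)) = avg f.
Proof.
move=> hi; rewrite /avg [in RHS](reindex h) //.
exact/onW_bij/injF_bij.
Qed.

Lemma markov_avg T (f : T -> R) (t : R) : (forall x, 0 <= f x) ->
  t * avg (fun x => (t <= f x)%R%:R) <= avg f.
Proof.
move=> f0; rewrite -avgZ; apply: le_avg => x.
by case: (lerP t (f x)) => h; rewrite ?mulr1 ?mulr0 ?f0.
Qed.

Lemma chebyshev_avg T (f : T -> R) (m t v : R) : 0 < t ->
  avg (fun x => (f x - m) ^+ 2) <= v ->
  avg (fun x => (t <= `|f x - m|)%R%:R) <= v / t ^+ 2.
Proof.
move=> t0 hv; rewrite ler_pdivlMr ?exprn_gt0 // mulrC; apply: le_trans hv.
apply: le_trans (markov_avg (t ^+ 2) (f := fun x => (f x - m) ^+ 2) _); last first.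
  by move=> x; exact: sqr_ge0.
rewrite ler_pM2l ?exprn_gt0 //; apply: le_avg => x.
rewrite ler_nat -(real_normK (num_real (f x - m))).
by case: lerP => // h; rewrite lerXn2r // nnegrE // ltW.
Qed.

End Average.

(** * First and second moments of the number of points of a permutation in a region *)

Section Perms.
Variables (R : realFieldType) (n : nat).
Implicit Types (u : 'S_n) (Q : rel 'I_n).

Lemma avg_perm_mulr (g : 'S_n) (f : 'S_n -> R) :
  avg (fun u => f (u * g)%g) = avg f.
Proof. by apply: avg_bij; exact: mulIg. Qed.

Lemma avg_perm_mull (g : 'S_n) (f : 'S_n -> R) :
  avg (fun u => f (g * u)%g) = avg f.
Proof. by apply: avg_bij; exact: mulgI. Qed.

Lemma card_perm_gt0 : (0 < #|{perm 'I_n}|)%N.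
Proof. by apply/card_gt0P; exists 1%g. Qed.

(** Multiplying by [tperm y z] shows that the average does not depend on [y], and the [n] averages
    sum to 1. *)
Lemma avg_perm1 (x y : 'I_n) : avg (fun u => (u x == y)%:R) = n%:R^-1 :> R.
Proof.
have n0 : n%:R != 0 :> R by rewrite pnatr_eq0; case: n x => // -[].
apply: (mulfI n0); rewrite divff //.
rewrite -[RHS](avg_cst 1 card_perm_gt0).
rewrite [RHS](eq_avg (g := fun u => \sum_(z : 'I_n) (u x == z)%:R)); last first.
  move=> u; rewrite (bigD1 (u x)) //= eqxx big1 ?addr0 // => z.
  by rewrite eq_sym => /negbTE ->.
rewrite avg_sum mulr_natl.
transitivity (\sum_(z : 'I_n) avg (fun u : 'S_n => (u x == y)%:R : R)).
  by rewrite sumr_const card_ord.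
apply: eq_bigr.
move=> z _; rewrite -[RHS](avg_perm_mulr (tperm y z)); apply: eq_avg => u.
by rewrite permM (canF_eq (tpermK _ _)) tpermR.
Qed.

(** The inequality also covers [y = y'], where the average is 0. Otherwise translation invariance
    makes the [n * (n - 1)] ordered pairs of distinct values equally likely. *)
Lemma avg_perm2 (x x' y y' : 'I_n) : x != x' ->
  avg (fun u => ((u x == y) && (u x' == y'))%:R) <= (n%:R * (n%:R - 1))^-1 :> R.
Proof.
move=> xx'.
have n2 : (1 < n)%N.
  have := max_card (mem [:: x; x']); rewrite card_ord => /(leq_trans _); apply.
  by rewrite (card_uniqP _) //= inE xx'.
have n0 : n%:R * (n%:R - 1) != 0 :> R.
  by rewrite mulf_neq0 ?subr_eq0 ?(eqr_nat _ _ 1) ?pnatr_eq0 //; case: n n2 => [|[]].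
have [->|yy'] := eqVneq y y'.
  rewrite (eq_avg (g := fun=> 0)) ?avg_cst ?card_perm_gt0 //; last first.
    move=> u; case: eqP => //= <-; case: eqP => // /perm_inj e.
    by rewrite e eqxx in xx'.
  rewrite invr_ge0 mulr_ge0 // subr_ge0 (ler_nat _ 1); exact: ltnW.
rewrite le_eqVlt; apply/orP; left; apply/eqP.
apply: (mulfI n0); rewrite divff //.
rewrite -[RHS](avg_cst 1 card_perm_gt0).
rewrite [RHS](eq_avg (g := fun u => \sum_(z : 'I_n) \sum_(z' | z' != z)
  ((u x == z) && (u x' == z'))%:R)); last first.
  move=> u; rewrite (bigD1 (u x)) //= eqxx (bigD1 (u x')) /=; last first.
    by rewrite (inj_eq perm_inj) eq_sym.
  rewrite eqxx big1 ?big1 ?addr0 //.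
    move=> z zx; rewrite big1 // => z' _; by rewrite eq_sym (negbTE zx).
  by move=> z' /andP[_]; rewrite eq_sym => /negbTE ->.
rewrite avg_sum -mulrA mulr_natl.
transitivity (\sum_(z : 'I_n) (n%:R - 1) *
  avg (fun u : 'S_n => ((u x == y) && (u x' == y'))%:R : R)).
  by rewrite sumr_const card_ord.
apply: eq_bigr.
move=> z _; rewrite avg_sum -(natrB _ (ltnW n2)) subn1 mulr_natl.
transitivity (\sum_(z' | z' != z)
  avg (fun u : 'S_n => ((u x == y) && (u x' == y'))%:R : R)).
  by rewrite sumr_const cardC1 card_ord.
apply: eq_bigr.
move=> z' z'z.
(* The first factor sends [y] to [z]; the second then moves the image of [y'] to [z'] and leaves [z]
   fixed. *)
pose g := (tperm y z * tperm (tperm y z y') z')%g.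
have gy : g y = z.
  by rewrite permM tpermL tpermD // -[X in _ != X](tpermL y z) (inj_eq perm_inj) eq_sym.
have gy' : g y' = z' by rewrite permM tpermL.
rewrite -[RHS](avg_perm_mulr g); apply: eq_avg => u.
rewrite 2!(permM u g) -[X in g (u x) == X]gy -[X in g (u x') == X]gy'.
by rewrite !(inj_eq perm_inj).
Qed.

Definition hits Q u : nat := (\sum_x Q x (u x))%N.

Definition weight Q : nat := (\sum_x \sum_y Q x y)%N.

Lemma hitsE Q u : (hits Q u)%:R = \sum_x (Q x (u x))%:R :> R.
Proof. by rewrite natr_sum. Qed.

Lemma weightE Q : (weight Q)%:R = \sum_x \sum_y (Q x y)%:R :> R.
Proof. by rewrite natr_sum; apply: eq_bigr => x _; rewrite natr_sum. Qed.

Lemma weight_le Q (c : nat) : (forall x, \sum_y Q x y <= c)%N ->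
  (weight Q <= n * c)%N.
Proof.
move=> hc; rewrite /weight -[X in (_ <= X * _)%N]card_ord -sum_nat_const.
exact: leq_sum.
Qed.

Lemma avg_entry Q x :
  avg (fun u => (Q x (u x))%:R) = (\sum_y (Q x y)%:R) / n%:R :> R.
Proof.
rewrite (eq_avg (g := fun u => \sum_y (Q x y)%:R * (u x == y)%:R)).
  by rewrite avg_sum mulr_suml; apply: eq_bigr => y _; rewrite avgZ avg_perm1.
move=> u; rewrite (bigD1 (u x)) //= eqxx mulr1 big1 ?addr0 // => y.
by rewrite eq_sym => /negbTE ->; rewrite mulr0.
Qed.

Lemma avg_hits Q : avg (fun u => (hits Q u)%:R) = (weight Q)%:R / n%:R :> R.
Proof.
rewrite (eq_avg (hitsE Q)) avg_sum weightE mulr_suml.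
by apply: eq_bigr => x _; exact: avg_entry.
Qed.

Lemma avg_entry2 Q x x' : x != x' ->
  avg (fun u => (Q x (u x))%:R * (Q x' (u x'))%:R) <=
  (\sum_y (Q x y)%:R) * (\sum_y (Q x' y)%:R) / (n%:R * (n%:R - 1)) :> R.
Proof.
move=> xx'.
rewrite (eq_avg (g := fun u => \sum_y \sum_y' ((Q x y)%:R * (Q x' y')%:R) *
   ((u x == y) && (u x' == y'))%:R)).
  rewrite avg_sum big_distrlr /= mulr_suml; apply: ler_sum => y _.
  rewrite avg_sum mulr_suml; apply: ler_sum => y' _.
  by rewrite avgZ ler_wpM2l ?mulr_ge0 // avg_perm2.
move=> u; rewrite (bigD1 (u x)) //= eqxx (bigD1 (u x')) //= eqxx mulr1.
rewrite !big1 ?addr0 //.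
  move=> y yx; rewrite big1 // => z' _.
  by rewrite eq_sym (negbTE yx) mulr0.
by move=> z'; rewrite eq_sym => /negbTE ->; rewrite mulr0.
Qed.

(** In the second moment the diagonal terms contribute at most [m]. The off-diagonal ones exceed
    [m ^ 2] by at most [m ^ 2 / (n - 1)], which is at most [2 * m] because [m <= n] and [n >= 2]. *)
Lemma hits_variance Q : (1 < n)%N ->
  avg (fun u => ((hits Q u)%:R - (weight Q)%:R / n%:R) ^+ 2)
  <= 3 * ((weight Q)%:R / n%:R) :> R.
Proof.
move=> n2; set m := _ / _.
have n0 : 2 <= n%:R :> R by rewrite (ler_nat _ 2).
have mE : (weight Q)%:R = m * n%:R.
  by rewrite /m mulfVK // lt0r_neq0 //; lra.
have m0 : 0 <= m by rewrite divr_ge0.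
have mn : m <= n%:R.
  rewrite ler_pdivrMr; last by lra.
  rewrite -natrM ler_nat; apply: weight_le => x.
  apply: leq_trans (leq_sum _ (fun y _ => leq_b1 (Q x y))) _.
  by rewrite sum_nat_const card_ord muln1.
rewrite (eq_avg (g := fun u => (hits Q u)%:R ^+ 2 +
   ((- (2 * m)) * (hits Q u)%:R + m ^+ 2))); last by move=> u; ring.
rewrite avgD (avgD (fun u => _ * _)) avgZ avg_hits -/m avg_cst ?card_perm_gt0 //.
have H2 : avg (fun u => (hits Q u)%:R ^+ 2) <= m + (m * n%:R) ^+ 2 / (n%:R * (n%:R - 1)).
  rewrite (eq_avg (g := fun u => \sum_x \sum_x' (Q x (u x))%:R * (Q x' (u x'))%:R)).
    rewrite avg_sum -mE weightE expr2 big_distrlr /= /m weightE !mulr_suml -big_split /=.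
    apply: ler_sum => x _; rewrite avg_sum (bigD1 x) //=.
    apply: lerD.
      rewrite -avg_entry; apply: le_avg => u; by case: (Q _ _); rewrite ?mulr1 ?mulr0.
    rewrite mulr_suml [leRHS](bigD1 x) //= -[leLHS]add0r; apply: lerD.
      by rewrite divr_ge0 ?mulr_ge0 ?sumr_ge0 //; lra.
    by apply: ler_sum => x' xx'; apply: avg_entry2; rewrite eq_sym.
  by move=> u; rewrite hitsE expr2 big_distrlr.
have H3 : (m * n%:R) ^+ 2 / (n%:R * (n%:R - 1)) <= m ^+ 2 + 2 * m.
  rewrite ler_pdivrMr; last by nra.
  (* After clearing the denominator, the right side minus the left side is the sum of these two
     products. *)
  have : 0 <= m * n%:R * (n%:R - m) by rewrite !mulr_ge0 // ?subr_ge0; lra.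
  have : 0 <= m * n%:R * (n%:R - 2) by rewrite !mulr_ge0 // ?subr_ge0; lra.
  nra.
lra.
Qed.

End Perms.

(** * Sorting a permutation on a subset, and the planted law *)

Section Sorting.
Variable n : nat.
Implicit Types (u : 'S_n) (A : {set 'I_n}).

(* Here u plays the role of s^-1, mapping values to positions. *)
Definition incr_on A u : bool :=
  [forall x in A, forall y in A, (x < y)%N ==> (u x < u y)%N].

Lemma incr_onP A u : reflect
  (forall x y, x \in A -> y \in A -> (x < y)%N -> (u x < u y)%N) (incr_on A u).
Proof.
apply: (iffP forall_inP) => [h x y xA yA|h x xA].
  by move/forall_inP: (h x xA) => /(_ y yA) /implyP.
by apply/forall_inP => y yA; apply/implyP; exact: h.
Qed.

Lemma incr_on_lt A u x y : incr_on A u -> x \in A -> y \in A ->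
  (u x < u y)%N = (x < y)%N.
Proof.
move=> /incr_onP h xA yA; case: (ltngtP x y) => xy; first exact: h.
  by apply/negbTE; rewrite -leqNgt ltnW // h.
by rewrite (val_inj xy) ltnn.
Qed.

Lemma incr_on_rank A u x : incr_on A u -> x \in A ->
  #|[set z in A | (z <= x)%N]| = #|[set y in u @: A | (y <= u x)%N]|.
Proof.
move=> h xA; rewrite -(card_imset _ (@perm_inj _ u)); apply: eq_card => y.
rewrite !inE; apply/imsetP/andP => [[z]|[/imsetP[z zA ->]] hz].
  rewrite inE => /andP[zA zx] ->; split; first exact: imset_f.
  by rewrite leqNgt (incr_on_lt h) // -leqNgt.
by exists z => //; rewrite inE zA leqNgt -(incr_on_lt h) // -leqNgt.
Qed.

Lemma card_le_inj (B : {set 'I_n}) x y : x \in B -> y \in B ->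
  #|[set z in B | (z <= x)%N]| = #|[set z in B | (z <= y)%N]| -> x = y.
Proof.
wlog xy : x y / (x <= y)%N.
  move=> W xB yB e; case: (leqP x y) => h; first exact: W.
  by apply/esym/W => //; exact: ltnW.
move=> xB yB /eqP e; apply/val_inj/eqP; rewrite eqn_leq xy /=.
have : [set z in B | (z <= x)%N] == [set z in B | (z <= y)%N].
  rewrite eqEcard (eqP e) leqnn andbT; apply/fintype.subsetP => z.
  by rewrite !inE => /andP[-> /leq_trans]; apply.
by move=> /eqP/setP/(_ y); rewrite !inE yB leqnn /= => ->.
Qed.

Lemma imset_perm_onM A (p : 'S_n) u : perm_on A p -> (p * u)%g @: A = u @: A.
Proof.
move=> pA; rewrite -[in RHS](im_perm_on pA) -imset_comp.
by apply: eq_imset => x; rewrite permM.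
Qed.

(** Both rearrangements have the same image [u @: A], and the rank of [x] in [A] determines which
    element of that image it receives. *)
Lemma incr_on_unique A u (p q : 'S_n) : perm_on A p -> perm_on A q ->
  incr_on A (p * u)%g -> incr_on A (q * u)%g -> p = q.
Proof.
move=> pA qA hp hq; apply/permP => x.
have [xA|xA] := boolP (x \in A); last by rewrite !(out_perm _ xA).
apply: (@perm_inj _ u); rewrite -!permM.
apply: (@card_le_inj (u @: A)).
- by rewrite -(imset_perm_onM u pA) imset_f.
- by rewrite -(imset_perm_onM u qA) imset_f.
rewrite -{1}(imset_perm_onM u pA) -(imset_perm_onM u qA).
by rewrite -!incr_on_rank.
Qed.

(* The rearrangement inequality: a maximiser of sum_x x * (p u)(x) has no
   inversion inside A, since exchanging the two values would increase it. *)
Lemma incr_on_exists A u : exists2 p : 'S_n, perm_on A p & incr_on A (p * u)%g.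
Proof.
pose F (p : 'S_n) := (\sum_(x : 'I_n) x * (p * u)%g x)%N.
have [p pA pmax] := @arg_maxnP _ 1%g (fun p : 'S_n => perm_on A p) F (perm_on1 A).
exists p => //; apply/incr_onP => x y xA yA xy; rewrite ltnNge; apply/negP => yx.
have neq : (p * u)%g y != (p * u)%g x by rewrite (inj_eq perm_inj) neq_ltn xy orbT.
have {}yx : ((p * u)%g y < (p * u)%g x)%N by rewrite ltn_neqAle yx andbT.
have xNy : x != y by rewrite neq_ltn xy.
have tA : perm_on A (tperm x y * p)%g.
  apply: perm_onM => //; apply/fintype.subsetP => z; rewrite inE; case: tpermP => [->|->|] //.
  by rewrite eqxx.
have := pmax _ tA; rewrite /= leqNgt => /negP; apply; rewrite /F.
rewrite (bigD1 x) // (bigD1 y) 1?eq_sym //= [ltnRHS](bigD1 x) // [in ltnRHS](bigD1 y) 1?eq_sym //=.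
rewrite -!mulgA !(permM (tperm x y)) tpermL tpermR.
rewrite [X in (_ < _ + (_ + X))%N](eq_bigr (fun i : 'I_n => (i * (p * u)%g i)%N)).
  rewrite !addnA ltn_add2r; move: xy yx; move: (nat_of_ord x) (nat_of_ord y).
  by move: (nat_of_ord ((p * u)%g x)) (nat_of_ord ((p * u)%g y)) => *; nia.
by move=> z /andP[zx zy]; rewrite permM tpermD // eq_sym.
Qed.

(** By [incr_on_exists] the default 1 is never taken, and by [incr_on_unique] the choice is
    canonical. *)
Definition sort_on A u : 'S_n :=
  (odflt 1 [pick p : 'S_n | perm_on A p && incr_on A (p * u)] * u)%g.

Lemma sort_onP A u :
  exists p : 'S_n, [/\ perm_on A p, incr_on A (p * u)%g & sort_on A u = (p * u)%g].
Proof.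
rewrite /sort_on; case: pickP => [p /andP[pA pu]|h]; first by exists p.
by have [p pA pu] := incr_on_exists A u; have := h p; rewrite pA pu.
Qed.

Lemma sum_incr_on (R : realFieldType) A u (f : 'S_n -> R) :
  \sum_(p : 'S_n | perm_on A p) (incr_on A (p * u)%g)%:R * f (p * u)%g
  = f (sort_on A u).
Proof.
have [p [pA pu ->]] := sort_onP A u.
rewrite (bigD1 p) //= pu mul1r big1 ?addr0 // => q /andP[qA].
case: (boolP (incr_on _ _)) => [qu|_ _]; last by rewrite mul0r.
by rewrite (incr_on_unique qA pA qu pu) eqxx.
Qed.

(** Among the [#|A|]! rearrangements [p * u] exactly one is increasing on [A], and each of them is
    uniform when [u] is. *)
Lemma avg_incr_on (R : realFieldType) A (f : 'S_n -> R) :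
  ((#|A|)`!)%:R * avg (fun u => (incr_on A u)%:R * f u) = avg (fun u => f (sort_on A u)).
Proof.
rewrite -(eq_avg (fun u => sum_incr_on A u f)) avg_sum.
rewrite (eq_bigr (fun=> avg (fun u => (incr_on A u)%:R * f u))) => [|p _].
  by rewrite sumr_const card_perm mulr_natl.
exact: (avg_perm_mull p (fun u => (incr_on A u)%:R * f u)).
Qed.

Variable k : nat.

(** Encodes a uniform [k]-subset by a uniform permutation, so that its element counts become
    instances of [hits] and [hits_variance] applies to them. *)
Definition first_preim (t : 'S_n) : {set 'I_n} := [set x | (t x < k)%N].

Lemma first_preimV u (t : 'S_n) : u @: first_preim t = first_preim (u^-1 * t)%g.
Proof.
apply/setP => y; rewrite inE permM; apply/imsetP/idP => [[x]|h].
  by rewrite inE => xt ->; rewrite permK.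
by exists ((u^-1)%g y); rewrite ?inE ?permKV.
Qed.

Hypothesis kn : (k <= n)%N.

Lemma card_first : #|[set x : 'I_n | (x < k)%N]| = k.
Proof.
rewrite -sum1dep_card -(big_ord_widen _ (fun=> 1%N) kn).
by rewrite sum_nat_const card_ord muln1.
Qed.

Lemma card_first_preim (t : 'S_n) : #|first_preim t| = k.
Proof.
rewrite -[RHS]card_first -(card_imset _ (@perm_inj _ t)); apply: eq_card => y.
apply/imsetP/idP => [[x]|]; rewrite inE => h; first by move=> ->; rewrite inE.
by exists ((t^-1)%g y); rewrite ?inE permKV.
Qed.

Lemma first_preim_onto A : #|A| = k -> exists t : 'S_n, first_preim t = A.
Proof.
move=> Ak; pose e := enum A ++ enum (~: A).
have es : size e = n by rewrite size_cat -!cardE cardsC card_ord.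
have eall x : x \in e by rewrite mem_cat !mem_enum inE orbN.
have ie x : (index x e < n)%N by rewrite -[X in (_ < X)%N]es index_mem.
have ti : injective (fun x => Ordinal (ie x)).
  move=> x y /(congr1 val) /= exy.
  by rewrite -(nth_index x (eall x)) exy nth_index.
exists (perm ti); apply/setP => x; rewrite inE permE /= index_cat mem_enum.
case: (boolP (x \in A)) => xA; last by rewrite -cardE Ak ltnNge leq_addr.
by rewrite -Ak cardE index_mem mem_enum.
Qed.

(** Left multiplication by one element of the fibre over [A] carries the fibre over the initial
    segment onto it. *)
Lemma card_first_preim_fiber A : #|A| = k ->
  #|[set t : 'S_n | first_preim t == A]| =
  #|[set t : 'S_n | first_preim t == [set x : 'I_n | (x < k)%N]]|.
Proof.
move=> /first_preim_onto[t0 <-]; rewrite -[RHS](card_imset _ (mulgI t0)).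
apply: eq_card => t; rewrite inE; apply/eqP/imsetP => [h|[r]].
  exists (t0^-1 * t)%g; last by rewrite mulKVg.
  rewrite inE -first_preimV h; apply/eqP/setP => x; rewrite inE.
  apply/imsetP/idP => [[y]|hx]; first by rewrite inE => ? ->.
  by exists ((t0^-1)%g x); rewrite ?inE permKV.
rewrite inE => /eqP/setP h ->; apply/setP => x.
by move: (h (t0 x)); rewrite !inE permM.
Qed.

Lemma avg_first_preim (R : realFieldType) (g : {set 'I_n} -> R) :
  \sum_(A : {set 'I_n} | #|A| == k) g A
  = #|[set A : {set 'I_n} | #|A| == k]|%:R * avg (fun t => g (first_preim t)).
Proof.
set c := #|[set t : 'S_n | first_preim t == [set x : 'I_n | (x < k)%N]]|.
have E (h : {set 'I_n} -> R) :
    \sum_(t : 'S_n) h (first_preim t) = c%:R * \sum_(A : {set 'I_n} | #|A| == k) h A.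
  rewrite (partition_big first_preim (fun A => #|A| == k)) => [|t _] /=.
    rewrite mulr_sumr; apply: eq_bigr => A /eqP Ak.
    rewrite (eq_bigr (fun=> h A)) => [|t /eqP-> //].
    by rewrite /c -(card_first_preim_fiber Ak) cardsE sumr_const mulr_natl.
  by rewrite card_first_preim.
(* The constant function expresses the number of permutations as [c] times the number of
   [k]-subsets, so the fibre size [c] cancels. *)
have := E (fun=> 1); rewrite !sumr_const.
have -> : #|[pred A : {set 'I_n} | #|A| == k]| = #|[set A : {set 'I_n} | #|A| == k]|.
  by rewrite cardsE.
move=> e; have p0 : #|{perm 'I_n}|%:R != 0 :> R by rewrite pnatr_eq0 -lt0n card_perm_gt0.
rewrite /avg E -[#|{perm _}|%:R]/(1 *+ _) e mulrA.
move: p0; rewrite -[#|{perm _}|%:R]/(1 *+ _) e mulf_eq0 negb_or => /andP[c0 s0].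
by field; rewrite c0 s0.
Qed.

Lemma Z_sum (R : realFieldType) (s : 'S_n) :
  (Z k s)%:R = \sum_(A : {set 'I_n} | #|A| == k) (incr_set s A)%:R :> R.
Proof.
rewrite /Z -sum1dep_card natr_sum big_mkcondr; apply: eq_bigr => A _.
by case: incr_set.
Qed.

(* The planted law: Z reweights the uniform law into that of a uniform permutation
   sorted on a uniform k-subset.  Each increasing pair arises from k! unsorted ones. *)
Lemma avg_Z (R : realFieldType) (f : 'S_n -> R) :
  (k`!)%:R * avg (fun s => (Z k s)%:R * f s^-1%g) =
  #|[set A : {set 'I_n} | #|A| == k]|%:R *
    avg (fun t => avg (fun u => f (sort_on (first_preim t) u))).
Proof.
rewrite -(avg_first_preim (fun A => avg (fun u => f (sort_on A u)))).
rewrite (eq_avg (g := fun s => \sum_(A : {set 'I_n} | #|A| == k)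
   (incr_on A s^-1%g)%:R * f s^-1%g)) => [|s]; last first.
  by rewrite Z_sum mulr_suml.
rewrite avg_sum mulr_sumr; apply: eq_bigr => A /eqP Ak.
rewrite -avg_incr_on Ak.
by rewrite (avg_bij (fun u => (incr_on A u)%:R * f u) invg_inj).
Qed.

End Sorting.

(** * The diagonal strip separates the planted law from the uniform one *)

Section Planting.
Variables (R : realFieldType) (n k h : nat).
Implicit Types (u t : 'S_n) (A B : {set 'I_n}).

Lemma sum_ord_lt (c : nat) : (\sum_(y < n) (y < c) = minn c n)%N.
Proof.
have [cn|nc] := leqP c n.
  rewrite -big_mkcond -(big_ord_widen _ (fun=> 1%N) cn).
  by rewrite sum_nat_const card_ord muln1.
rewrite (eq_bigr (fun=> 1%N)) => [|y _]; first by rewrite sum_nat_const card_ord muln1.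
by rewrite (ltn_trans (ltn_ord y) nc).
Qed.

Definition strip : rel 'I_n := fun x y => ((x < y + 3 * h) && (y < x + 3 * h))%N.

Lemma strip_weight : (0 < h)%N -> (weight strip <= n * (6 * h))%N.
Proof.
move=> h0; apply: weight_le => x.
(* Row [x] of the strip is a difference of two initial segments; truncated subtraction handles rows
   near 0. *)
have : (\sum_y strip x y + \sum_(y < n) (y < x.+1 - 3 * h) <=
        \sum_(y < n) (y < x + 3 * h))%N.
  rewrite -big_split /=; apply: leq_sum => y _; rewrite /strip.
  case: (ltnP x (y + 3 * h)); case: (ltnP y (x + 3 * h));
    by case: (ltnP y (x.+1 - 3 * h)) => //=; lia.
rewrite !sum_ord_lt; have := ltn_ord x; lia.
Qed.

Definition box (c : nat) : rel 'I_n := fun x y => ((x < c) && (y < k))%N.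

Lemma box_weight (c : nat) : (k <= n)%N -> weight (box c) = (minn c n * k)%N.
Proof.
move=> kn; rewrite -sum_ord_lt big_distrl; apply: eq_bigr => x _ /=.
rewrite (eq_bigr (fun y : 'I_n => (x < c) * (y < k))%N) => [|y _]; last first.
  by rewrite /box; case: (x < c)%N; case: (y < k)%N.
by rewrite -big_distrr /= sum_ord_lt (minn_idPl kn).
Qed.

Lemma hits_box (c : nat) t :
  hits (box c) t = #|[set z in first_preim k t | (z < c)%N]|.
Proof.
rewrite -sum1dep_card big_mkcond; apply: eq_bigr => x _.
by rewrite /box inE andbC; case: ifP.
Qed.

(** Half the expected number of chosen elements in one grid cell, so that two such errors together
    amount to one cell. *)
Definition dev : R := k%:R * h%:R / (2 * n%:R).

(** The range of [j] reaches the first grid point beyond any element of ['I_n]; such a point may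
    exceed [n], hence the [minn]. *)
Definition balanced A : bool :=
  [forall j : 'I_(n %/ h + 2),
    `|#|[set z in A | (z < j * h)%N]|%:R - (minn (j * h) n * k)%:R / n%:R| < dev].

(** If [y >= x + 3 * h], the grid point [p * h] just above [x] and the one [q * h] at or below [y]
    are at least a cell apart. Balance then puts more elements of [B] below [q * h] than elements of
    [A] below [p * h], while equal ranks force the opposite. *)
Lemma rank_close A B (x y : 'I_n) : (0 < h)%N -> (0 < k)%N ->
  balanced A -> balanced B -> x \in A -> y \in B ->
  #|[set z in A | (z <= x)%N]| = #|[set z in B | (z <= y)%N]| ->
  (y < x + 3 * h)%N.
Proof.
move=> h0 k0 /forallP bA /forallP bB xA yB rk; rewrite ltnNge; apply/negP => xy.
set p := (x %/ h).+1; set q := (y %/ h)%N.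
have xn := ltn_ord x; have yn := ltn_ord y.
have pJ : (p < n %/ h + 2)%N by rewrite addn2 !ltnS leq_div2r // ltnW.
have qJ : (q < n %/ h + 2)%N.
  by have := leq_div2r h (ltnW yn); rewrite -/q; lia.
have hp1 : (x < p * h)%N by rewrite -ltn_divLR.
have hp2 : (p * h <= x + h)%N by rewrite mulSn addnC leq_add2r leq_divM.
have hq1 : (q * h <= y)%N by rewrite leq_divM.
have hq2 : (y < q * h + h)%N by rewrite -mulSnr -ltn_divLR.
have pq : (p + 1 <= q)%N by rewrite -(leq_pmul2r h0); lia.
have rA : (#|[set z in A | (z <= x)%N]| <= #|[set z in A | (z < p * h)%N]|)%N.
  apply: subset_leq_card; apply/fintype.subsetP => z.
  by rewrite !inE => /andP[->] /leq_ltn_trans; apply.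
have rB : (#|[set z in B | (z < q * h)%N]| <= #|[set z in B | (z <= y)%N]|)%N.
  apply: subset_leq_card; apply/fintype.subsetP => z.
  by rewrite !inE => /andP[->] /leq_trans /(_ hq1) /ltnW.
have := bA (Ordinal pJ); have := bB (Ordinal qJ) => /=.
rewrite !ltr_norml => /andP[hB _] /andP[_ hA].
rewrite (minn_idPl (leq_trans hq1 (ltnW yn))) in hB.
have n0 : 0 < n%:R :> R by rewrite ltr0n; lia.
have e : (minn (p * h) n * k)%:R / n%:R + 2 * dev <= (q * h * k)%:R / n%:R.
  rewrite -subr_ge0 (_ : _ - _ =
    ((q * h * k)%:R - (minn (p * h) n * k)%:R - k%:R * h%:R) / n%:R); last first.
    by rewrite /dev; field; rewrite lt0r_neq0.
  rewrite divr_ge0 // -natrM -addrA -opprD -natrD subr_ge0 ler_nat.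
  have : ((p * h + h) * k <= q * h * k)%N.
    by rewrite leq_mul2r -mulSnr leq_mul2r -addn1 pq !orbT.
  have : (minn (p * h) n * k <= p * h * k)%N by rewrite leq_mul2r geq_minl orbT.
  lia.
have : (#|[set z in B | (z < q * h)%N]| <= #|[set z in A | (z < p * h)%N]|)%N.
  by rewrite (leq_trans rB) // -rk.
rewrite -(ler_nat R); move: hA hB e; clear; lra.
Qed.

Lemma sorted_in_strip A u x : (0 < h)%N -> (0 < k)%N ->
  balanced A -> balanced (u @: A) -> incr_on A u -> x \in A -> strip x (u x).
Proof.
move=> h0 k0 bA bB uA xA; have uxA : u x \in u @: A by exact: imset_f.
have rk := incr_on_rank uA xA.
by apply/andP; split; [apply: (rank_close _ _ bB bA)|apply: (rank_close _ _ bA bB)].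
Qed.

(** Sorting moves every point over [A] into the strip and leaves the others alone; the only double
    counting is of points over [A] that were in the strip before. *)
Lemma hits_sort A u : (0 < h)%N -> (0 < k)%N -> balanced A -> balanced (u @: A) ->
  (#|A| + hits strip u <= hits strip (sort_on A u) + \sum_(x in A) strip x (u x))%N.
Proof.
move=> h0 k0 bA bB; have [p [pA pu ->]] := sort_onP A u.
rewrite -(imset_perm_onM u pA) in bB.
rewrite /hits (bigID (mem A)) [in leqRHS](bigID (mem A)) /= -sum1_card.
rewrite [X in (_ <= X + _ + _)%N](eq_bigr (fun=> 1%N)) => [|x xA]; last first.
  by rewrite (sorted_in_strip h0 k0 bA bB).
rewrite [X in (_ <= _ + X + _)%N](eq_bigr (fun x => strip x (u x) : nat)); last first.
  by move=> x xA; rewrite permM (out_perm pA).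
by rewrite -[leqRHS]addnA leq_add2l addnC.
Qed.

Hypotheses (h0 : (0 < h)%N) (k0 : (0 < k)%N) (kn : (k <= n)%N) (n2 : (1 < n)%N).

Let m : R := (weight strip)%:R / n%:R.

Lemma strip_mean_le : m <= 6 * h%:R.
Proof.
rewrite ler_pdivrMr ?ltr0n; last by lia.
rewrite -natrM -natrM ler_nat mulnC; exact: strip_weight h0.
Qed.

(** A union bound over grid points, with Chebyshev for each [box], whose mean number of hits is at
    most [k]. *)
Lemma avg_unbalanced :
  avg (fun t => (~~ balanced (first_preim k t))%:R) <=
  (n %/ h + 2)%:R * (3 * k%:R / dev ^+ 2) :> R.
Proof.
have n0 : 0 < n%:R :> R by rewrite ltr0n; lia.
have d0 : 0 < dev by rewrite /dev divr_gt0 ?mulr_gt0 // ltr0n.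
apply: (@le_trans _ _ (avg (fun t => \sum_(j < n %/ h + 2)
  (dev <= `|(hits (box (j * h)) t)%:R - (weight (box (j * h)))%:R / n%:R|)%R%:R))).
  apply: le_avg => t; case: (boolP (balanced _)) => [_|]; first by rewrite sumr_ge0.
  rewrite negb_forall => /existsP[j]; rewrite -leNgt => hj.
  rewrite (bigD1 j) //= hits_box box_weight // hj lerDl sumr_ge0 //.
rewrite avg_sum -[X in X%:R * _]card_ord mulr_natl -sumr_const; apply: ler_sum => j _.
apply: chebyshev_avg => //; apply: le_trans (hits_variance _ _ n2) _.
rewrite ler_wpM2l // box_weight // ler_pdivrMr // -natrM ler_nat mulnC.
by rewrite leq_mul2l geq_minr orbT.
Qed.

Lemma avg_hits_on u :
  avg (fun t => (\sum_(x in first_preim k t) strip x (u x))%:R) =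
  k%:R / n%:R * (hits strip u)%:R :> R.
Proof.
pose Q : rel 'I_n := fun x y => strip x (u x) && (y < k)%N.
rewrite (eq_avg (g := fun t => (hits Q t)%:R)) => [|t]; last first.
  rewrite big_mkcond; congr _%:R; apply: eq_bigr => x _.
  by rewrite inE /Q; case: (t x < k)%N; rewrite ?andbT ?andbF.
rewrite avg_hits.
have -> : weight Q = (hits strip u * k)%N.
  rewrite /hits big_distrl; apply: eq_bigr => x _ /=.
  rewrite (eq_bigr (fun y : 'I_n => strip x (u x) * (y < k))%N) => [|y _].
    by rewrite -big_distrr /= sum_ord_lt (minn_idPl kn).
  by rewrite /Q; case: strip; case: (y < k)%N.
by rewrite mulnC natrM mulrAC.
Qed.

Definition typical u : bool := (hits strip u)%:R < m + k%:R / 4.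

Lemma avg_hits_far :
  avg (fun u => (k%:R / 4 <= `|(hits strip u)%:R - m|)%R%:R) <=
  3 * m / (k%:R / 4) ^+ 2 :> R.
Proof.
by apply: chebyshev_avg; rewrite ?divr_gt0 ?ltr0n //; exact: hits_variance.
Qed.

(** The sorted permutation can be typical only if the strip count of [u] is at least [k / 4] away
    from its mean, or at least [k / 4] of the strip points already lie over the subset, or the
    subset or its set of positions is unbalanced. Otherwise the count is at least [m + k / 2]. *)
Lemma avg_sorted_typical :
  avg (fun t => avg (fun u => (typical (sort_on (first_preim k t) u))%:R)) <=
  3 * m / (k%:R / 4) ^+ 2 + 4 * m / n%:R
  + 2 * ((n %/ h + 2)%:R * (3 * k%:R / dev ^+ 2)) :> R.
Proof.
have k0R : 0 < k%:R :> R by rewrite ltr0n.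
have n0R : 0 < n%:R :> R by rewrite ltr0n; lia.
have P0 := card_perm_gt0 n.
pose far u : R := (k%:R / 4 <= `|(hits strip u)%:R - m|)%R%:R.
pose on t u : R := (\sum_(x in first_preim k t) strip x (u x))%:R.
pose many t u : R := (k%:R / 4 <= on t u)%R%:R.
pose unb t : R := (~~ balanced (first_preim k t))%:R.
have key t u : (typical (sort_on (first_preim k t) u))%:R <=
    far u + many t u + (unb t + unb (u^-1 * t)%g).
  have le1 (b : bool) (x : R) : 1 <= x -> b%:R <= x.
    by apply: le_trans; rewrite lern1 leq_b1.
  rewrite /unb -first_preimV /far /many.
  case: (boolP (balanced (first_preim k t))) => [bA|_] /=; last first.
    by rewrite le1 // addrCA lerDl !addr_ge0.
  case: (boolP (balanced _)) => [bB|_] /=; last first.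
    by rewrite le1 // add0r lerDr !addr_ge0.
  rewrite !addr0.
  case: (lerP (k%:R / 4) `|_|) => [_|h1] /=; first by rewrite le1 // lerDl.
  case: (lerP (k%:R / 4) (on t u)) => [_|h2] /=; first by rewrite le1 // add0r.
  have h4 : m + k%:R / 4 <= (hits strip (sort_on (first_preim k t) u))%:R.
    have := hits_sort h0 k0 bA bB; rewrite (card_first_preim kn).
    rewrite -(ler_nat R) !natrD -/(on t u) => h3.
    move: h1; rewrite ltr_norml => /andP[h1 _]; lra.
  by rewrite /typical ltNge h4 /= addr0.
have farE : avg far <= 3 * m / (k%:R / 4) ^+ 2 by exact: avg_hits_far.
(* Markov for each [t], after exchanging the averages: the mean number of strip points over the
   subset is [k / n * m]. *)
have manyE : avg (fun t => avg (many t)) <= 4 * m / n%:R.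
  have -> : 4 * m / n%:R = 4 / k%:R * (k%:R / n%:R * m).
    by field; rewrite !lt0r_neq0.
  have {1}-> : m = avg (fun u => (hits strip u)%:R) by rewrite avg_hits.
  rewrite -avgZ -(eq_avg avg_hits_on).
  have -> : avg (fun u => avg (fun t => on t u)) = avg (fun t => avg (fun u => on t u)).
    rewrite /avg -!mulr_suml exchange_big /=.
    by congr (_ * _); rewrite !mulr_suml.
  rewrite -avgZ; apply: le_avg => t.
  rewrite -[leLHS]mul1r -[X in X * _](mulVf (lt0r_neq0 (_ : 0 < k%:R / 4))) ?divr_gt0 //.
  rewrite -mulrA invf_div ler_wpM2l ?divr_ge0 //.
  exact: markov_avg.
have unbE := avg_unbalanced; rewrite -/unb in unbE.
apply: (@le_trans _ _ (avg (fun t => avg (fun u =>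
  far u + many t u + (unb t + unb (u^-1 * t)%g))))).
  by apply: le_avg => t; apply: le_avg => u; exact: key.
(* For fixed [t], [u^-1 * t] is uniform, so the set of positions is unbalanced as often as the
   subset. *)
have unb2 : avg (fun t => avg (fun u => unb t + unb (u^-1 * t)%g)) = avg unb + avg unb.
  rewrite (eq_avg (g := fun t => unb t + avg (fun u => unb (u^-1 * t)%g))).
    rewrite avgD; congr (_ + _).
    rewrite (eq_avg (g := fun=> avg unb)) ?avg_cst // => t.
    rewrite (avg_bij (fun u => unb (u * t)%g) invg_inj).
    exact: (avg_perm_mulr t unb).
  by move=> t; rewrite avgD avg_cst.
have -> : avg (fun t => avg (fun u => far u + many t u + (unb t + unb (u^-1 * t)%g)))
   = avg far + avg (fun t => avg (many t)) + (avg unb + avg unb).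
  rewrite -unb2 -[in RHS](avg_cst (avg far) P0) -2!avgD; apply: eq_avg => t.
  by rewrite avgD avgD.
lra.
Qed.

(** With [m <= 6 * h], the error terms are at most [288 * h / k ^ 2], [24 * h / n] and twice
    [36 * n ^ 3 / (k * h ^ 3)]. The constants, 16 times 288, 24 and 36, make these fractions at most
    1/16 each, for a total of 1/4. *)
Hypotheses (hk : (4608 * h <= k ^ 2)%N) (hn : (384 * h <= n)%N)
  (hkn : (576 * n ^ 3 <= k * h ^ 3)%N).

Lemma spread_small : 3 * m / (k%:R / 4) ^+ 2 <= 1 / 16.
Proof.
have k0R : 0 < k%:R :> R by rewrite ltr0n.
move: hk; rewrite -(ler_nat R) natrM natrX => hkR.
rewrite ler_pdivrMr ?exprn_gt0 ?divr_gt0 //.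
rewrite expr_div_n; have := strip_mean_le; lra.
Qed.

Lemma avg_atypical : avg (fun u => (~~ typical u)%:R) <= 1 / 16 :> R.
Proof.
apply: le_trans spread_small; apply: le_trans avg_hits_far; apply: le_avg => u.
rewrite /typical -leNgt; case: (lerP (m + _)) => //= hu.
have -> // : k%:R / 4 <= `|(hits strip u)%:R - m|.
by rewrite (le_trans _ (ler_norm _)) //; lra.
Qed.

Lemma avg_sorted_typical_small :
  avg (fun t => avg (fun u => (typical (sort_on (first_preim k t) u))%:R)) <= 1 / 4 :> R.
Proof.
apply: le_trans avg_sorted_typical _.
have k0R : 0 < k%:R :> R by rewrite ltr0n.
have h0R : 0 < h%:R :> R by rewrite ltr0n.
have n0R : 0 < n%:R :> R by rewrite ltr0n; lia.
have H1 := spread_small.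
have H2 : 4 * m / n%:R <= 1 / 16.
  rewrite ler_pdivrMr //; move: hn; rewrite -(ler_nat R) natrM.
  have := strip_mean_le; lra.
have H3 : (n %/ h + 2)%:R * (3 * k%:R / dev ^+ 2) <= 1 / 16.
  (* The extra 2 is absorbed because [h <= n]. *)
  have J : (n %/ h + 2)%:R <= 3 * n%:R / h%:R :> R.
    rewrite ler_pdivlMr // -!natrM ler_nat mulnDl.
    have := leq_divM n h; lia.
  have -> : 3 * k%:R / dev ^+ 2 = 12 * n%:R ^+ 2 / (k%:R * h%:R ^+ 2).
    by rewrite /dev; field; rewrite !lt0r_neq0.
  apply: (@le_trans _ _ (3 * n%:R / h%:R * (12 * n%:R ^+ 2 / (k%:R * h%:R ^+ 2)))).
    by rewrite ler_wpM2r // divr_ge0 ?mulr_ge0 ?exprn_ge0 // ltW.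
  have -> : 3 * n%:R / h%:R * (12 * n%:R ^+ 2 / (k%:R * h%:R ^+ 2)) =
     36 * n%:R ^+ 3 / (k%:R * h%:R ^+ 3) :> R by field; rewrite !lt0r_neq0.
  rewrite ler_pdivrMr ?mulr_gt0 ?exprn_gt0 //.
  by move: hkn; rewrite -(ler_nat R) (natrM _ 576) (natrM _ k) !natrX; lra.
lra.
Qed.

End Planting.

(** * From separation to failure of the law, and the choice of the grid step *)

(** On typical permutations with ratio within 1/2 of 1, [Z] is at least half its mean. So the mean
    of [Z] over typical permutations is at least [EZ / 2 * (1 - D - 1 / 16)], yet the planted law
    bounds it by [EZ / 4]. *)
Lemma deviation_lower_bound (R : realType) (n k h : nat) :
  (0 < h)%N -> (0 < k)%N -> (k <= n)%N -> (1 < n)%N ->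
  (4608 * h <= k ^ 2)%N -> (384 * h <= n)%N -> (576 * n ^ 3 <= k * h ^ 3)%N ->
  7 / 16 <= Pn R (fun s : 'S_n => 1 / 2 < `|(Z k s)%:R / EZ R n k - 1|).
Proof.
move=> h0 k0 kn n2 hk hn hkn.
pose typ (u : 'S_n) := typical R k h u.
pose far (s : 'S_n) := 1 / 2 < `|(Z k s)%:R / EZ R n k - 1|.
set D := Pn _ _.
have P0 := card_perm_gt0 n.
have DE : D = avg (fun s => (far s)%:R).
  rewrite /D /Pn /avg; congr (_ / _); rewrite -sum1_card natr_sum big_mkcond.
  by apply: eq_bigr => s _; rewrite inE /far; case: ifP.
have EZE : EZ R n k = avg (fun s : 'S_n => (Z k s)%:R) by [].
have kf0 : 0 < k`!%:R :> R by rewrite ltr0n fact_gt0.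
(* The planted-law identity with the constant test function 1. *)
have E1 : k`!%:R * EZ R n k = #|[set A : {set 'I_n} | #|A| == k]|%:R.
  have := avg_Z kn (R := R) (fun=> 1); rewrite EZE.
  rewrite (eq_avg (g := fun s : 'S_n => (Z k s)%:R)) => [->|s]; last by rewrite mulr1.
  by rewrite !avg_cst // mulr1.
have A0 : 0 < #|[set A : {set 'I_n} | #|A| == k]|%:R :> R.
  rewrite ltr0n; apply/card_gt0P; exists (first_preim k (1%g : 'S_n)).
  by rewrite inE card_first_preim.
have EZ0 : 0 < EZ R n k by rewrite -(pmulr_rgt0 _ kf0) E1.
have E2 : avg (fun s => (Z k s)%:R * (typ s^-1%g)%:R) <= EZ R n k / 4.
  rewrite -(ler_pM2l kf0) (avg_Z kn (fun u => (typ u)%:R)) [leRHS]mulrA E1 ler_wpM2l //.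
  by rewrite -[leRHS]mul1r; exact: avg_sorted_typical_small.
have T : avg (fun s : 'S_n => (~~ typ s^-1%g)%:R) <= 1 / 16 :> R.
  rewrite (avg_bij (fun u => (~~ typ u)%:R) invg_inj).
  exact: avg_atypical.
have key s : EZ R n k / 2 * (1 + (-1 * (far s)%:R + -1 * (~~ typ s^-1%g)%:R)) <=
    (Z k s)%:R * (typ s^-1%g)%:R.
  have EZ2 : 0 <= EZ R n k / 2 by rewrite divr_ge0 // ltW.
  case: (typ _) => /=; last first.
    by rewrite mulr0 mulr_ge0_le0 //; case: (far s) => /=; lra.
  rewrite /far; case: (ltrP (1 / 2)) => [_|] /=.
    by rewrite mulr0 mulr1 addr0 subrr mulr0.
  rewrite !mulr0 !addr0 !mulr1 ler_norml => /andP[h1 _].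
  rewrite -ler_pdivlMl // mulrC; lra.
have := le_trans (le_avg key) E2.
rewrite avgZ avgD avg_cst // (avgD (fun s => -1 * (far s)%:R)) !avgZ -DE.
rewrite [leRHS](_ : _ = EZ R n k / 2 * (1 / 2)); last by field.
have EZ2 : 0 < EZ R n k / 2 by rewrite divr_gt0.
rewrite ler_pM2l //; move: (avg _) T D {DE} => a a16 d; lra.
Qed.

(* Take h minimal for the last inequality: then k h^3 < 8 * 576 n^3 = 4608 n^3. *)
Lemma grid_step_exists (n k c : nat) : (0 < k)%N -> (k <= n)%N -> (4608 <= c)%N ->
  (c ^ 4 <= k)%N -> (c ^ 4 * n ^ 3 <= k ^ 7)%N ->
  exists h, [/\ 0 < h, 4608 * h <= k ^ 2, 384 * h <= n & 576 * n ^ 3 <= k * h ^ 3]%N.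
Proof.
move=> k0 kn hc ck cnk.
have n0 : (0 < n)%N by exact: leq_trans kn.
have exh : exists h, (576 * n ^ 3 <= k * h ^ 3)%N.
  exists (576 * n)%N; rewrite expnMn mulnA leq_mul2r; apply/orP; right.
  by rewrite (leq_trans _ (leq_pmull _ k0)).
have [h hP hmin] := ex_minnP exh.
(* This gives [h <= 2 * h.-1], the source of the factor 8 when minimality is applied to [h.-1]. *)
have h1 : (1 < h)%N.
  case: h hP {hmin} => [|[|h]] //; first by rewrite muln0 leqNgt muln_gt0 expn_gt0 n0.
  rewrite exp1n muln1 => hh; have : (n <= n ^ 3)%N by rewrite -[X in (X <= _)%N]expn1 leq_pexp2l.
  lia.
have hlt : (k * h ^ 3 < c * n ^ 3)%N.
  have : (k * h.-1 ^ 3 < 576 * n ^ 3)%N.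
    by rewrite ltnNge; apply/negP => /hmin; lia.
  have : (h ^ 3 <= 8 * h.-1 ^ 3)%N.
    by rewrite -(expnMn 2 _ 3) leq_exp2r //; lia.
  rewrite -(leq_pmul2l k0) => a b.
  have : (4608 * n ^ 3 <= c * n ^ 3)%N by rewrite leq_mul2r hc orbT.
  lia.
(* Bounding the right side by [k ^ 7] yields [c * h <= k ^ 2], and by [k * n ^ 3] yields
   [c * h <= n], after taking cube roots. *)
have chk : (k * (c * h) ^ 3 <= c ^ 4 * n ^ 3)%N.
  have : (c ^ 3 * (k * h ^ 3) <= c ^ 3 * (c * n ^ 3))%N.
    by rewrite leq_mul2l (ltnW hlt) orbT.
  by rewrite expnMn [leqRHS]mulnA -expnSr mulnCA.
exists h; split => //; first exact: ltnW.
  have : (c * h <= k ^ 2)%N.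
    rewrite -(leq_exp2r _ _ (isT : 0 < 3)%N) -(leq_pmul2l k0) -expnM -expnS.
    exact: leq_trans cnk.
  by apply: leq_trans; rewrite leq_mul2r hc orbT.
have : (c * h <= n)%N.
  rewrite -(leq_exp2r _ _ (isT : 0 < 3)%N) -(leq_pmul2l k0).
  by apply: leq_trans chk _; rewrite leq_mul2r ck orbT.
by apply: leq_trans; rewrite leq_mul2r (leq_trans _ hc) ?orbT.
Qed.

(** With [x] the power 4/9 of [n], [x ^ 28 >= x ^ 27 = n ^ 12] gives [x ^ 7 >= n ^ 3]; then raise
    [M * x <= k] to the seventh power. *)
Lemma size_from_ratio (R : realType) (n k M : nat) : (0 < n)%N -> (0 < M)%N ->
  M%:R < k%:R / ((n%:R : R) `^ (4 / 9)) -> (M <= k)%N /\ (M * n ^ 3 <= k ^ 7)%N.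
Proof.
move=> n0 M0; set x := _ `^ _ => hx.
have n1 : 1 <= n%:R :> R by rewrite ler1n.
have x9 : x ^+ 9 = n%:R ^+ 4.
  rewrite -powR_mulrn ?powR_ge0 // -powRrM -powR_mulrn //.
  by congr (_ `^ _); field.
have x0 : 0 < x by rewrite powR_gt0 // (lt_le_trans ltr01).
have x1 : 1 <= x by rewrite -(@expr_ge1 _ 9 x _ (ltW x0)) // x9 exprn_ege1.
have x7 : n%:R ^+ 3 <= x ^+ 7.
  rewrite -(@ler_pXn2r _ 4) ?nnegrE ?exprn_ge0 ?(ltW x0) // -!exprM.
  rewrite (mulnC 3) exprM -x9 -exprM ler_weXn2l //.
have M1 : 1 <= M%:R :> R by rewrite ler1n.
have Mxk : M%:R * x <= k%:R by rewrite -ler_pdivlMr // ltW.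
split.
  rewrite -(ler_nat R) (le_trans _ Mxk) // ler_peMr //.
rewrite -(ler_nat R) natrM !natrX.
apply: (@le_trans _ _ ((M%:R * x) ^+ 7)); last first.
  by rewrite lerXn2r // nnegrE // mulr_ge0 // ltW.
rewrite exprMn ler_pM ?exprn_ge0 // ler_eXnr //.
Qed.

Local Open Scope classical_set_scope.

Theorem theorem1 (R : realType) (k : nat -> nat)
  (hk : forall n : nat, (0 < n)%N -> (0 < k n)%N && (k n <= n)%N)
  (hlimsup : forall (M : R) (N : nat),
      exists2 n : nat, (N <= n)%N & M < (k n)%:R / ((n%:R : R) `^ (4 / 9)))
  : ~ (forall eps : R, 0 < eps ->
         (fun n : nat => Pn R (fun s : 'S_n =>
              eps < `| (Z (k n) s)%:R / EZ R n (k n) - 1 |)) @ \oo --> (0 : R)).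
Proof.
move=> lln; have /lln/cvgrPdist_lt : 0 < 1 / 2 :> R by lra.
(* Any bound below 7/16 would contradict [deviation_lower_bound]. *)
move=> /(_ (1 / 4)) [|N _ HN]; first by lra.
(* The constant stays abstract so that [c ^ 4] is never evaluated. *)
have [c hc] : exists c, (4608 <= c)%N by exists 4608.
have [n Nn] := hlimsup (c ^ 4)%:R (maxn N 2).
have /andP[NN n2] : (N <= n)%N && (1 < n)%N by rewrite -geq_max.
have n0 := ltnW n2.
have /andP[k0 kn] := hk n n0.
move=> /(size_from_ratio n0) []; first by rewrite expn_gt0 (leq_trans _ hc).
move=> ck /(grid_step_exists k0 kn hc ck) [h [h0 h1 h2 h3]].
have /= := HN n NN; rewrite sub0r normrN.
have := deviation_lower_bound R h0 k0 kn n2 h1 h2 h3.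
set D := Pn _ _ => D1 D2; have := ler_norm D; lra.
Qed.
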